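(* There is an inclusion of mould subspaces $ARI_{\underline{al}/\underline{al}}\subset ARI_{al+push/circneut}$. Moreover, for $r\in\{1,2,3\}$, $ARI^r\cap ARI_{\underline{al}/\underline{al}}=ARI^r\cap ARI_{al+push/circneut}$.
   Context: $ARI$ is the space of moulds $A=(A^r)_{r\ge0}$ with $A^r\in\mathbb{Q}(u_1,\dots,u_r)$ and $A^0=0$; $\overline{ARI}$ is the same with variables $v_1,v_2,\dots$. $ARI^r$ is the subspace of moulds concentrated in depth $r$ (i.e. $A^s=0$ for $s\ne r$). $swap:ARI\to\overline{ARI}$ is $swap(A)(v_1,\dots,v_r)=A(v_r,v_{r-1}-v_r,\dots,v_1-v_2)$. A mould is alternal if for every $r\ge2$ and $1\le i\le[r/2]$, $\sum_{w}A^r(w)=0$, the sum over all shuffles $w$ of $(u_1,\dots,u_i)$ and $(u_{i+1},\dots,u_r)$ (no condition in depth 1); the same definition applies in $\overline{ARI}$. $A$ is push-invariant if $A(u_0,u_1,\dots,u_{r-1})=A(u_1,\dots,u_r)$ for all $r$, $u_0=-u_1-\dots-u_r$. $B\in\overline{ARI}$ is circ-neutral if $\sum_{i=0}^{r-1}B(v_{i+1},\dots,v_r,v_1,\dots,v_i)=0$ for all $r>1$. $ARI_{\underline{al}/\underline{al}}$ is the space of alternal $A\in ARI$ with alternal swap and with $A^1(-u_1)=A^1(u_1)$. $ARI_{al+push/circneut}$ is the space of alternal, push-invariant $A\in ARI$ whose swap is circ-neutral. *)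

(* Defs.v *)
From HB Require Import structures.
From mathcomp Require Import all_boot all_order all_algebra all_fingroup.
From mathcomp Require Import generic_quotient fraction.
From mathcomp Require Import mpoly.
Set Implicit Arguments. Unset Strict Implicit. Unset Printing Implicit Defensive.
Import Order.TTheory GRing.Theory Num.Theory.
Local Open Scope ring_scope.

(* Q(u_1,...,u_r); the variable u_(i+1) is 'X_i, i : 'I_r. *)
Definition rfun (r : nat) := {fraction {mpoly rat[r]}}.

(* A mould: one rational function in r variables for each depth r.
   The same type serves for ARI (variables u) and \bar{ARI} (variables v). *)
Definition mould := forall r : nat, rfun r.

Definition is_mould (A : mould) : Prop := A 0%N = 0.

Definition concentrated (r : nat) (A : mould) : Prop :=
  forall s : nat, s <> r -> A s = 0.

(* the variable with (0-based) index k, i.e. x_(k+1); 0 if out of range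
   (never used out of range below) *)
Definition Xn (r k : nat) : {mpoly rat[r]} :=
  match @insub nat (fun j => j < r)%N _ k with
  | Some i => 'X_i
  | None => 0
  end.

(* Substitution of the variables x_(i+1) := l_i (polynomials) in a rational
   function: numerator and denominator of a representative are substituted.
   For the invertible linear substitutions used below this is the usual
   field automorphism of Q(x_1,...,x_r). *)
Definition subst (r : nat) (l : r.-tuple {mpoly rat[r]}) (f : rfun r) : rfun r :=
  let x := repr f in
  (tofrac ((\n_x) \mPo l)) / (tofrac ((\d_x) \mPo l)).

Definition swap_tuple (r : nat) : r.-tuple {mpoly rat[r]} :=
  [tuple (if val i == 0%N then Xn r r.-1
          else Xn r (r.-1 - val i) - Xn r (r - val i)) | i < r].

Definition swap (A : mould) : mould := fun r => subst (swap_tuple r) (A r).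

(* shuffles of (u_1..u_i) and (u_(i+1)..u_r): words w_(j+1) = u_(s j + 1)
   with s a permutation preserving the relative order inside each block *)
Definition is_shuffle (r i : nat) (s : 'S_r) : bool :=
  [forall j : 'I_r, forall k : 'I_r,
     ((j < k)%N && ((s j < i)%N == (s k < i)%N)) ==> (s j < s k)%N].

Definition perm_tuple (r : nat) (s : 'S_r) : r.-tuple {mpoly rat[r]} :=
  [tuple 'X_(s j) | j < r].

Definition alternal (A : mould) : Prop :=
  forall r : nat, (2 <= r)%N -> forall i : nat, (1 <= i <= r./2)%N ->
    \sum_(s : 'S_r | is_shuffle i s) subst (perm_tuple s) (A r) = 0.

(* push-invariance: A(u_0, u_1, ..., u_(r-1)) = A(u_1, ..., u_r),
   u_0 = - u_1 - ... - u_r *)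
Definition push_tuple (r : nat) : r.-tuple {mpoly rat[r]} :=
  [tuple (if val i == 0%N then - \sum_(j < r) 'X_j else Xn r (val i).-1) | i < r].

Definition push_invariant (A : mould) : Prop :=
  forall r : nat, subst (push_tuple r) (A r) = A r.

Definition circ_tuple (r i : nat) : r.-tuple {mpoly rat[r]} :=
  [tuple Xn r ((val k + i) %% r) | k < r].

Definition circ_neutral (B : mould) : Prop :=
  forall r : nat, (1 < r)%N ->
    \sum_(i < r) subst (circ_tuple r i) (B r) = 0.

Definition neg_tuple1 : 1.-tuple {mpoly rat[1]} := [tuple - 'X_i | i < 1].

Definition ARI_al_al (A : mould) : Prop :=
  is_mould A /\ alternal A /\ alternal (swap A) /\
  subst neg_tuple1 (A 1%N) = A 1%N.

Definition ARI_alpush_circneut (A : mould) : Prop :=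
  is_mould A /\ alternal A /\ push_invariant A /\ circ_neutral (swap A).

(* Main.v *)
(** The value of a mould at a word of linear forms that are independent under
    substitution turns the statement into combinatorics of words.

    Alternality yields f (u a v) = (-1)^|u| f (a (rev u sh v)). For v empty this
    is invariance under reversal up to sign; summed over the rotations of a word
    it becomes an antipode sum, which vanishes: alternal implies circ-neutral.
    Reversal invariance of A and of swap A combine into
    A (push w) = A (- w), so the odd part O of A is alternal and changes sign
    under push; two shuffle relations with a single letter then give 2 O = 0 in
    depth at least 2, whence push-invariance.

    Conversely, write swap A (x, y, z) = H (0, z, y, x) in depth 3, with H
    translation invariant and, by push-invariance, cyclically invariant. The
    difference of the circ-neutrality relations based at two of the four points
    is swap A (x, y, z) = swap A (z, y, x), which turns circ-neutrality into
    alternality. In depth 2 the two conditions coincide. *)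

From mathcomp Require Import all_boot all_algebra all_fingroup.
From mathcomp Require Import ssrAC ring zify.
From mathcomp Require Import generic_quotient fraction mpoly.
Require Import Defs.

Set Implicit Arguments. Unset Strict Implicit. Unset Printing Implicit Defensive.
Import GRing.Theory.

(** * Shuffles of words *)

(** The nested recursion is structural in each of the two words. The result is a list and keeps
    multiplicities, so sums over it are right even when letters repeat. *)
Fixpoint shuffle (T : Type) (u : seq T) : seq T -> seq (seq T) :=
  if u is a :: u' then
    fix shuffle_u v := if v is b :: v' then
        map (cons a) (shuffle u' v) ++ map (cons b) (shuffle_u v')
      else [:: u]
  else fun v => [:: v].

Section Shuffles.
Local Open Scope ring_scope.

Lemma shuffle0r (T : Type) (u : seq T) : shuffle u [::] = [:: u].
Proof. by case: u. Qed.

Lemma map_shuffle (T T' : Type) (g : T -> T') (u v : seq T) :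
  shuffle (map g u) (map g v) = map (map g) (shuffle u v).
Proof.
elim: u v => [|a u IHu] v //=; elim: v => [|b v IHv] //=.
by rewrite -(map_cons g b v) IHu IHv map_cat -!map_comp.
Qed.

(** When [p] separates the letters of the two words, the factor from which each letter of [w] comes
    can be read off from the letter itself. *)
Lemma mem_shuffle (T : eqType) (p : pred T) (u v w : seq T) :
    all p u -> all (predC p) v ->
  (w \in shuffle u v) = (filter p w == u) && (filter (predC p) w == v).
Proof.
have cons_inj (a : T) : injective (cons a) by move=> s t [].
elim: w u v => [|c w IHw] u v pu pv.
  case: u pu => [|a u] pu; case: v pv => [|b v] pv //=.
  by rewrite mem_cat; apply/negP=> /orP[] /mapP[].
have IH0 s : (c :: w \in map (cons c) s) = (w \in s) by rewrite mem_map.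
have IH1 a s : a != c -> (c :: w \in map (cons a) s) = false.
  by move=> ac; apply/negP=> /mapP[t _ [] ca _]; rewrite ca eqxx in ac.
case: u pu => [|a u] pu; last case: v pv => [|b v] pv.
- rewrite /= inE; case: ifPn => pc /=.
    case: v pv => [|b v] //= /andP[pb _].
    by rewrite eqseq_cons; case: eqP => //= cb; rewrite -cb pc in pb.
  case: v pv => [|b v] /=; first by rewrite andbF.
  case/andP=> pb pv; rewrite !eqseq_cons.
  by have := IHw [::] v erefl pv; rewrite /= inE => ->; rewrite andbCA.
- rewrite /= inE; case: ifPn => pc /=; last first.
    rewrite andbF eqseq_cons; case: eqP => //= ca.
    by case/andP: pu => pa _; rewrite ca pa in pc.
  case/andP: pu => pa pu; rewrite !eqseq_cons.
  by have := IHw u [::] pu erefl; rewrite shuffle0r inE => ->; rewrite andbA.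
rewrite [shuffle _ _]/= mem_cat.
case/andP: (pu) => pa pu'; case/andP: (pv) => pb pv'; rewrite /=.
case: ifPn => pc /=; rewrite !eqseq_cons.
  rewrite orbC IH1; last by apply: contraNneq pb => ->; rewrite pc.
  case: (eqVneq c a) => [<-|ca]; last by rewrite IH1 // eq_sym.
  by rewrite IH0 IHw.
rewrite IH1; last by apply: contraNneq pc => <-.
case: (eqVneq c b) => [<-|cb]; last by rewrite andbF /= IH1 // eq_sym.
by rewrite IH0 (IHw (a :: u)).
Qed.

Lemma uniq_shuffle (T : eqType) (p : pred T) (u v : seq T) :
  all p u -> all (predC p) v -> uniq (shuffle u v).
Proof.
have cons_inj (a : T) : injective (cons a) by move=> s t [].
elim: u v => [|a u IHu] v //= /andP[pa pu]; elim: v => [|b v IHv] //= /andP[pb pv].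
rewrite cat_uniq !map_inj_uniq // IHu ?IHv //= ?pb // andbT.
by apply/hasPn => _ /mapP[w _ ->]; apply/negP => /mapP[x _ [ab _]]; rewrite ab pa in pb.
Qed.

Lemma pairwise_eq_filter (T : Type) (p : pred T) (e : rel T) (s : seq T) :
  pairwise (fun a b => (p a == p b) ==> e a b) s =
  pairwise e (filter p s) && pairwise e (filter (predC p) s).
Proof.
elim: s => //= a s ->; case: ifP => pa /=; rewrite all_filter.
  by rewrite -andbA.
by rewrite andbCA.
Qed.

Definition perm_word (r : nat) (s : 'S_r) : seq nat := [seq val (s j) | j <- enum 'I_r].

Lemma size_perm_word r (s : 'S_r) : size (perm_word s) = r.
Proof. by rewrite size_map size_enum_ord. Qed.

Lemma nth_perm_word r (s : 'S_r) (j : 'I_r) : nth 0%N (perm_word s) j = s j.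
Proof. by rewrite (nth_map j) ?size_enum_ord // nth_ord_enum. Qed.

Lemma is_shuffleE r i (s : 'S_r) :
  is_shuffle i s =
  pairwise (fun a b => ((a < i)%N == (b < i)%N) ==> (a < b)%N) (perm_word s).
Proof.
apply/idP/idP => [/forallP sh|/(pairwiseP 0%N) sh].
  apply/(pairwiseP 0%N) => j k; rewrite !inE size_perm_word => jr kr jk.
  have /forallP/(_ (Ordinal kr)) := sh (Ordinal jr).
  by rewrite -!nth_perm_word /= jk.
apply/forallP => j; apply/forallP => k; apply/implyP => /andP[jk].
have := sh j k; rewrite !inE size_perm_word !nth_perm_word.
by move=> /(_ (ltn_ord j) (ltn_ord k) jk)/implyP.
Qed.

Lemma perm_word_iota r (s : 'S_r) : perm_eq (perm_word s) (iota 0 r).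
Proof.
apply: uniq_perm; rewrite ?iota_uniq //.
  by rewrite map_inj_uniq ?enum_uniq // => x y /val_inj/perm_inj.
move=> k; rewrite mem_iota add0n /=; apply/mapP/idP => [[j _ ->]|kr]; first exact: ltn_ord.
by exists (s^-1%g (Ordinal kr)); rewrite ?mem_enum //= permKV.
Qed.

Lemma perm_word_inj r : injective (@perm_word r).
Proof.
by move=> s t st; apply/permP => j; apply: val_inj; rewrite /= -!nth_perm_word st.
Qed.

Lemma perm_wordP r (w : seq nat) :
  perm_eq w (iota 0 r) -> exists s : 'S_r, perm_word s = w.
Proof.
move=> pw; have sw : size w = r by rewrite (perm_size pw) size_iota.
have uw : uniq w by rewrite (perm_uniq pw) iota_uniq.
have wr (j : 'I_r) : (nth 0 w j < r)%N.
  have := mem_nth 0%N (_ : (j < size w)%N); rewrite sw => /(_ (ltn_ord j)).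
  by rewrite (perm_mem pw) mem_iota.
have inj : injective (fun j : 'I_r => Ordinal (wr j)).
  move=> j k [] /eqP; rewrite nth_uniq ?sw //.
  by move=> /eqP /val_inj.
exists (perm inj); apply: (@eq_from_nth _ 0%N); rewrite size_perm_word //.
by move=> j jr; rewrite (nth_perm_word _ (Ordinal jr)) permE.
Qed.

(** Each of the two subwords of the one-line notation of [s] rearranges an interval, and the only
    increasing rearrangement of an interval is the interval itself. *)
Lemma is_shuffle_mem r i (s : 'S_r) : (i <= r)%N ->
  is_shuffle i s = (perm_word s \in shuffle (iota 0 i) (iota i (r - i))).
Proof.
move=> ir; have lt_i : all (gtn i) (iota 0 i).
  by apply/allP => k; rewrite mem_iota.
have ge_i : all (predC (gtn i)) (iota i (r - i)).
  by apply/allP => k; rewrite mem_iota /= -leqNgt => /andP[].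
rewrite (mem_shuffle _ lt_i ge_i) is_shuffleE pairwise_eq_filter.
have iotaE : iota 0 r = iota 0 i ++ iota i (r - i) by rewrite -iotaD subnKC.
have pwp : perm_eq (filter (gtn i) (perm_word s)) (iota 0 i).
  rewrite (perm_trans (perm_filter _ (perm_word_iota s))) // iotaE filter_cat.
  by rewrite (all_filterP lt_i) (eq_in_filter (a2 := pred0)) ?filter_pred0 ?cats0 //
    => k /(allP ge_i)/negbTE.
have pwq : perm_eq (filter (predC (gtn i)) (perm_word s)) (iota i (r - i)).
  rewrite (perm_trans (perm_filter _ (perm_word_iota s))) // iotaE filter_cat.
  rewrite (all_filterP ge_i) (eq_in_filter (a2 := pred0)) ?filter_pred0 //.
  by move=> k /(allP lt_i) /= ->.
have srt t m n : perm_eq t (iota m n) -> pairwise ltn t = (t == iota m n).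
  move=> pt; apply/idP/eqP => [st|->]; last first.
    by rewrite -(sorted_pairwise ltn_trans) iota_ltn_sorted.
  apply: (irr_sorted_eq ltn_trans ltnn) (perm_mem pt).
    by rewrite (sorted_pairwise ltn_trans).
  exact: iota_ltn_sorted.
by congr (_ && _); apply: srt.
Qed.

(** Words of indices have distinct letters, so both index sets are enumerated without repetition and
    have the same members. The letters of [l], possibly repeated, are put in by [map_shuffle]. *)
Lemma sum_is_shuffle (T : Type) (x0 : T) (V : nmodType) (F : seq T -> V) r i l :
    size l = r -> (i <= r)%N ->
  \sum_(s : 'S_r | is_shuffle i s) F [seq nth x0 l k | k <- perm_word s] =
  \sum_(w <- shuffle (take i l) (drop i l)) F w.
Proof.
move=> sl ir; have lE : [seq nth x0 l k | k <- iota 0 r] = l.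
  by rewrite -[in RHS](mkseq_nth x0 l) sl.
rewrite -[in take i l]lE -[in drop i l]lE -map_take -map_drop map_shuffle big_map.
rewrite take_iota (minn_idPl ir) drop_iota add0n.
transitivity (\sum_(w <- [seq perm_word s | s <- index_enum 'S_r & is_shuffle i s])
                F [seq nth x0 l k | k <- w]); first by rewrite big_map big_filter.
apply: perm_big; apply: uniq_perm.
- by rewrite (map_inj_uniq (@perm_word_inj r)) filter_uniq ?index_enum_uniq.
- apply: (@uniq_shuffle _ (gtn i)); apply/allP => k; rewrite mem_iota //=.
  by rewrite -leqNgt => /andP[].
move=> w; apply/mapP/idP => [[s]|wsh].
  by rewrite mem_filter is_shuffle_mem // => /andP[? _] ->.
suff /perm_wordP[s sw] : perm_eq w (iota 0 r).
  by exists s => //; rewrite mem_filter is_shuffle_mem // sw wsh mem_index_enum.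
move: wsh; rewrite (@mem_shuffle _ (gtn i)); first last.
- by apply/allP => k; rewrite mem_iota /= -leqNgt => /andP[].
- by apply/allP => k; rewrite mem_iota.
case/andP => /eqP wl /eqP wr.
rewrite -(perm_filterC (gtn i) w) wl wr.
by rewrite -{2}(subnKC ir) iotaD perm_refl.
Qed.

End Shuffles.

(** * Alternal functions on words: reversal and cyclic sums *)

Section AlternalWords.
Local Open Scope ring_scope.
Variables (T : eqType) (K : nzRingType).
Implicit Types (u v w p q : seq T) (F : seq T -> K) (D : seq T -> Prop).

Lemma shuffle_sum_cons F a u b v :
  \sum_(w <- shuffle (a :: u) (b :: v)) F w =
  \sum_(w <- shuffle u (b :: v)) F (a :: w) + \sum_(w <- shuffle (a :: u) v) F (b :: w).
Proof. by rewrite /= big_cat !big_map. Qed.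

Lemma shuffle_sumC F u v :
  \sum_(w <- shuffle u v) F w = \sum_(w <- shuffle v u) F w.
Proof.
elim: u v F => [|a u IHu] v F; first by rewrite shuffle0r.
elim: v F => [|b v IHv] F //.
by rewrite !shuffle_sum_cons addrC IHu IHv.
Qed.

Lemma shuffle_sum1_rcons F a v b :
  \sum_(w <- shuffle [:: a] (rcons v b)) F w =
  \sum_(w <- shuffle [:: a] v) F (rcons w b) + F (rcons (rcons v b) a).
Proof.
elim: v F => [|c v IHv] F.
  by rewrite /= !big_cons !big_nil !addr0.
by rewrite rcons_cons !shuffle_sum_cons IHv /= !big_seq1 addrA.
Qed.

Lemma perm_shuffle u v w : w \in shuffle u v -> perm_eq w (u ++ v).
Proof.
elim: u v w => [|a u IHu] v w; first by rewrite inE => /eqP ->.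
elim: v w => [|b v IHv] w; first by rewrite shuffle0r inE cats0 => /eqP ->.
rewrite /= mem_cat => /orP[] /mapP[z zs ->]; first by rewrite perm_cons IHu.
have /seq.permP zv := IHv _ zs.
apply/seq.permP => x.
by rewrite /= zv /= !count_cat /= -(addnCA (x b)) addnA (addnC (x b)) -!addnA.
Qed.

Lemma antipode_sum F w : w != [::] ->
  \sum_(k < (size w).+1) (-1) ^+ (size w - k) *
     \sum_(z <- shuffle (rev (drop k w)) (take k w)) F z = 0.
Proof.
(* Words starting with the first letter of w and words starting with its last
   letter cancel separately, by induction on the length. *)
move: {2}(size w) (erefl (size w)) => n; elim: n w F => [[]//|n IHn] w F sw _.
case: n IHn => [_|n IHn] in sw *.
  case: w sw => [|a []] // _.
  by rewrite !big_ord_recl big_ord0 /= !big_seq1 expr1 expr0 addr0 mulN1r mul1r addNr.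
case: w sw => [|d w] // [sw].
have [t [c wE]] : exists t c, d :: w = rcons t c.
  by case/lastP: w sw => // w c _; exists (d :: w), c; rewrite rcons_cons.
have st : size t = n.+1 by move: (congr1 size wE); rewrite size_rcons /= sw => -[].
have Sd : \sum_(k < n.+2) (-1) ^+ (n.+1 - k) *
    \sum_(z <- shuffle (rev (drop k w)) (take k w)) F (d :: z) = 0.
  by rewrite -[n.+1]sw (IHn w (fun z => F (d :: z))) //; case: (w) sw.
have Sc : \sum_(k < n.+2) (-1) ^+ (n.+1 - k) *
    \sum_(z <- shuffle (rev (drop k t)) (take k t)) F (c :: z) = 0.
  by rewrite -[n.+1]st (IHn t (fun z => F (c :: z))) //; case: (t) st.
rewrite /= sw big_ord_recl big_ord_recr /=.
rewrite big_ord_recr /= in Sd; rewrite big_ord_recl /= in Sc.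
have dropc k : (k <= n.+1)%N -> rev (drop k (d :: w)) = c :: rev (drop k t).
  move=> kn; rewrite wE -cats1 drop_cat st; case: ltnP => nk; first by rewrite rev_cat.
  have -> : k = n.+1 by apply/eqP; rewrite eqn_leq kn.
  by rewrite subnn drop0 drop_oversize ?st.
have take_t k : (k <= n.+1)%N -> take k (d :: w) = take k t.
  by move=> kn; rewrite wE -cats1 takel_cat // st.
(* The reversed suffix starts with [c] and the prefix with [d], so a middle term splits by first
   letter into a term of [Sd] and a term of [Sc]. The two end terms complete these sums. *)
have mid (k : 'I_n.+1) : (-1) ^+ (n.+2 - bump 0 k) *
   \sum_(z <- shuffle (rev (drop (bump 0 k) (d :: w))) (take (bump 0 k) (d :: w))) F z =
   (-1) ^+ (n.+1 - k) * (\sum_(z <- shuffle (rev (drop k w)) (take k w)) F (d :: z)) -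
   (-1) ^+ (n.+1 - bump 0 k) *
     (\sum_(z <- shuffle (rev (drop (bump 0 k) t)) (take (bump 0 k) t)) F (c :: z)).
  rewrite /bump leq0n add1n.
  have kn : (k < n.+1)%N by [].
  rewrite dropc // [take _ (d :: w)]/= shuffle_sum_cons mulrDr addrC; congr (_ + _).
  by rewrite subSn // exprS mulN1r mulNr -take_t.
rewrite (eq_bigr _ (fun k _ => mid k)) sumrB.
move/eqP: Sd; rewrite addr_eq0 => /eqP ->.
move/eqP: Sc; rewrite addr_eq0 -eqr_oppLR => /eqP <-.
rewrite add0n (drop_oversize (s := w)) ?sw // (take_oversize (s := w)) ?sw //.
rewrite shuffle0r (dropc 0%N) // take0 drop0 shuffle0r /= !big_seq1.
rewrite /bump leq0n add1n !subnn !subn0 [(-1) ^+ n.+2]exprS.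
by rewrite mulN1r mulNr opprK addrAC addNr add0r addNr.
Qed.

(** The predicate [D] stands for the words at which evaluating a rational function makes sense; it
    becomes independence of the letters. *)
Definition alternal_on D F :=
  forall u v, u != [::] -> v != [::] -> D (u ++ v) -> \sum_(w <- shuffle u v) F w = 0.

Section Alternal.
Variables (D : seq T -> Prop) (F : seq T -> K).
Hypothesis D_perm : forall s t, perm_eq s t -> D s -> D t.
Hypothesis F_alt : alternal_on D F.

(** Induction on [p]: the relation for [b :: p] and [a :: q] says that the words starting with [b]
    and those starting with [a] have opposite sums, which moves [b] behind [a] at the cost of a
    sign. *)
Lemma alternal_split p a q : D (rev p ++ a :: q) ->
  F (rev p ++ a :: q) = (-1) ^+ size p * \sum_(w <- shuffle p q) F (a :: w).
Proof.
elim: p a q => [|b p IHp] a q; first by rewrite big_seq1 mul1r.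
rewrite rev_cons cat_rcons => Dw; rewrite IHp // exprS mulN1r mulNr -mulrN.
congr (_ * _); apply/eqP; rewrite -addr_eq0 -shuffle_sum_cons; apply/eqP.
apply: F_alt => //; apply: D_perm Dw.
by apply/seq.permP => x; rewrite !count_cat count_rev /= addnCA -!addnA addnCA.
Qed.

Lemma alternal_rev w : D w -> F (rev w) = (-1) ^+ (size w).-1 * F w.
Proof.
case: w => [|a p] Dw; first by rewrite mul1r.
rewrite rev_cons -cats1 alternal_split ?shuffle0r ?big_seq1 //.
by apply: D_perm Dw; rewrite cats1 -rev_cons perm_sym perm_rev.
Qed.

Lemma alternal_cyclic w : D w -> (1 < size w)%N ->
  \sum_(i < size w) F (rot i w) = 0.
Proof.
case: w => [|a w] // Dw w0; rewrite -[RHS](@antipode_sum (fun z => F (a :: z)) w); last first.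
  by case: w w0 {Dw}.
(* The trivial rotation matches the last antipode term, [k = size w]; rotation by [k + 1] is
   [drop k w ++ a :: take k w] and matches term [k] by [alternal_split]. *)
rewrite big_ord_recl big_ord_recr /= addrC drop_size take_size big_seq1 subnn mul1r rot0.
congr (_ + _); apply: eq_bigr => k _.
rewrite -(size_drop k w) -(size_rev (drop k w)) -alternal_split revK ?rot1_cons //.
apply: D_perm Dw; rewrite -{1}(cat_take_drop k w) perm_sym.
by apply/seq.permP => x; rewrite /= !count_cat /= addnCA (addnC (count x (drop _ _))).
Qed.

End Alternal.
End AlternalWords.

(** * Push-invariance from alternality of a function and of its swap *)

Section Push.
Local Open Scope ring_scope.
Variables (T : zmodType) (K : comNzRingType).
Implicit Types (u v w : seq T) (F : seq T -> K) (D : seq T -> Prop).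

Definition push_word w := belast (- \sum_(x <- w) x) w.

(** On a reversed word this is the substitution that defines [swap]; partial sums invert it. *)
Definition diff_word w := pairmap (fun x y => y - x) 0 w.

Definition sum_word w := scanl +%R 0 w.

Lemma size_push_word w : size (push_word w) = size w.
Proof. exact: size_belast. Qed.

Lemma size_diff_word w : size (diff_word w) = size w.
Proof. exact: size_pairmap. Qed.

Lemma size_sum_word w : size (sum_word w) = size w.
Proof. exact: size_scanl. Qed.

Lemma sum_wordK : cancel sum_word diff_word.
Proof. by apply: scanlK => x y; rewrite addrC addKr. Qed.

Lemma diff_wordK : cancel diff_word sum_word.
Proof. by apply: pairmapK => x y; rewrite addrC subrK. Qed.

(** Reversal conjugated by the swap substitution is, up to reversal and sign, the push. For w =
    (u_1, ..., u_r) the reversed partial sums are - (u_i + ... + u_r), and their differences are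
    u_0, u_1, ..., u_(r-1). *)
Lemma diff_word_rev_sum w :
  diff_word (rev (sum_word (rev (map -%R w)))) = push_word w.
Proof.
pose S w := rev (sum_word (rev (map -%R w))).
have Scons a s : S (a :: s) = - (\sum_(x <- a :: s) x) :: S s.
  rewrite /S /= rev_cons /sum_word -cats1 scanl_cat rev_cat; congr (_ :: _).
  rewrite foldl_rev big_cons opprD addrC; congr (_ + _).
  elim: s => [|b s IHs] /=; first by rewrite big_nil oppr0.
  by rewrite IHs big_cons opprD addrC.
suff pS x : pairmap (fun x y => y - x) x (S w) = belast (- \sum_(y <- w) y - x) w.
  by rewrite /diff_word pS subr0.
elim: w x => [|a w IHw] x //; rewrite Scons /= IHw big_cons.
by rewrite opprK addrCA addNr addr0.
Qed.

Lemma alternal_on_opp D F :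
    (forall w, D w -> D (map -%R w)) ->
  alternal_on D F -> alternal_on D (fun w => F (map -%R w)).
Proof.
move=> Dopp F_alt u v u0 v0 Duv; rewrite -(big_map (map -%R) xpredT F) -map_shuffle.
apply: F_alt; rewrite -?size_eq0 ?size_map ?size_eq0 // -map_cat; exact: Dopp.
Qed.

Variable D : seq T -> Prop.
Hypothesis D_perm : forall s t, perm_eq s t -> D s -> D t.
Hypothesis D_push : forall w, D w -> D (push_word w).
Hypothesis D_opp : forall w, D w -> D (map -%R w).
Hypothesis D_sum : forall w, D w -> D (sum_word w).

Lemma alternal_antipush_eq0 F w :
    GRing.lreg (2 : K) -> alternal_on D F -> (forall u, D u -> F (push_word u) = - F u) ->
  (1 < size w)%N -> D w -> F w = 0.
Proof.
(* With c = - (x + b + sum v), the letters x, b, v, c have zero sum: the relation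
   shuffling x into b v and the one shuffling x into v c agree up to sign except
   on the term F (x b v). *)
move=> reg2 F_alt F_push; case: w => [|x [|b v]] // _ Dw.
pose c := - \sum_(y <- x :: b :: v) y.
(* The push of x v b is c x v, so [c] can replace [b] without leaving [D]. *)
have Dc : D (x :: rcons v c).
  have /D_push : D (rcons (x :: v) b).
    by apply: D_perm Dw; rewrite perm_sym rcons_cons perm_cons perm_rcons.
  rewrite /push_word belast_rcons rcons_cons => Dcx; apply: D_perm Dcx.
  apply/seq.permP => y; rewrite /= -!cats1 !count_cat /= !addn0 addnCA (addnC (count y v)).
  by rewrite /c !big_cons big_cat big_seq1 /= (addrC _ b).
have alt1 := F_alt [:: x] (b :: v) erefl erefl Dw.
have alt2 : \sum_(z <- shuffle [:: x] (rcons v c)) F z = 0.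
  by apply: (F_alt [:: x] (rcons v c)) => //; case: (v).
rewrite shuffle_sum_cons big_seq1 in alt1.
rewrite shuffle_sum1_rcons in alt2.
have sum_c : x + b + \sum_(y <- v) y + c = 0.
  by rewrite /c !big_cons addrA subrr.
have D_sh z : z \in shuffle [:: x] v -> D (rcons z c).
  move=> /perm_shuffle zv; apply: D_perm Dc; rewrite perm_sym -rcons_cons.
  by rewrite -!cats1 perm_cat2r.
have push_sh z : z \in shuffle [:: x] v -> push_word (rcons z c) = b :: z.
  move=> /perm_shuffle zv; rewrite /push_word belast_rcons -cats1 big_cat big_seq1 /=.
  rewrite (perm_big _ zv) /= big_cons; congr (_ :: _); apply: addr0_eq.
  by rewrite -[RHS]sum_c (ACl (1 * 4 * 2 * 3)).
have sumE : \sum_(z <- shuffle [:: x] v) F (b :: z) =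
            - \sum_(z <- shuffle [:: x] v) F (rcons z c).
  rewrite -sumrN; apply: eq_big_seq => z zs.
  by rewrite -push_sh // F_push //; apply: D_sh.
have D1 : D (rcons (rcons v c) x).
  by apply: D_perm Dc; rewrite perm_sym perm_rcons.
have push1 : push_word (rcons (rcons v c) x) = b :: rcons v c.
  rewrite /push_word belast_rcons -!cats1 !big_cat !big_seq1 /=; congr (_ :: _).
  by apply: addr0_eq; rewrite -[RHS]sum_c (ACl (3 * 4 * 1 * 2)).
have push2 : push_word (b :: rcons v c) = x :: b :: v.
  rewrite /push_word /= belast_rcons big_cons -!cats1 !big_cat !big_seq1 /=.
  by congr (_ :: _); apply: addr0_eq; rewrite -[RHS]sum_c addrA (ACl (4 * 1 * 2 * 3)).
(* Push sends v c x to b v c and then to x b v, and the two signs cancel. *)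
have : F (x :: b :: v) = F (rcons (rcons v c) x).
  by rewrite -push2 F_push -push1 ?F_push ?opprK //; apply: D_push.
move=> FE; apply: reg2; rewrite mulr0 mulr2n mulrDl mul1r {2}FE.
rewrite sumE in alt1.
by rewrite (subr0_eq alt1).
Qed.

(** The swapped function takes the value [F (push_word w)] at [v], and at [rev v] the value of [F]
    at the reversed negated word. Reversing [v] and then reversing that word introduce the same
    sign, as all lengths agree. *)
Lemma alternal_swap_push_opp F w :
    alternal_on D F -> alternal_on D (fun v => F (diff_word (rev v))) ->
  D w -> F (push_word w) = F (map -%R w).
Proof.
move=> F_alt G_alt Dw; set v := sum_word (rev (map -%R w)).
have Dopp := D_opp Dw.
have Dr : D (rev (map -%R w)) by apply: D_perm Dopp; rewrite perm_sym perm_rev.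
have Dv : D v by apply: D_sum.
have := alternal_rev D_perm G_alt Dv; rewrite /= revK sum_wordK diff_word_rev_sum.
rewrite (alternal_rev D_perm F_alt) // /v size_sum_word size_rev size_map.
by move/(inv_inj (signrMK _)).
Qed.

Lemma alternal_swap_push F w :
    GRing.lreg (2 : K) -> alternal_on D F ->
    alternal_on D (fun v => F (diff_word (rev v))) ->
  (1 < size w)%N -> D w -> F (push_word w) = F w.
Proof.
move=> reg2 F_alt G_alt w1 Dw.
have push_opp u : D u -> F (push_word u) = F (map -%R u).
  exact: alternal_swap_push_opp.
have map_oppK u : map -%R (map -%R u) = u :> seq T.
  by rewrite -map_comp map_id_in // => x _ /=; rewrite opprK.
have opp_push u : map -%R (push_word u) = push_word (map -%R u).
  rewrite /push_word big_map sumrN; move: (- _) => x.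
  by elim: u x => [|a u IHu] x //=; rewrite IHu.
rewrite push_opp //; apply/esym/eqP; rewrite -subr_eq0; apply/eqP.
(* The odd part of [F] is alternal because negation acts letter by letter. It changes sign under
   push because push becomes negation inside [F] and commutes with negation of words. So it
   vanishes. *)
apply: (@alternal_antipush_eq0 (fun u => F u - F (map -%R u))) => // [u t u0 t0 Dut|u Du].
  by rewrite sumrB F_alt // (alternal_on_opp D_opp F_alt) ?subrr.
rewrite push_opp // opp_push push_opp ?map_oppK ?opprB //; exact: D_opp.
Qed.

End Push.

(** * Substitution of independent words in rational functions *)

Section Substitution.
Local Open Scope ring_scope.
Variable r : nat.
Local Notation P := {mpoly rat[r]}.
Local Notation tofrac := (@FracField.tofrac P).
Implicit Types (l w : seq P) (f g : rfun r) (p q : P).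

Lemma frac_repr (R : idomainType) (f : {fraction R}) :
  f = FracField.tofrac \n_(repr f) / FracField.tofrac \d_(repr f).
Proof.
have d0 := denom_ratioP (repr f).
apply: (canRL (mulfK _)); first by rewrite tofrac_eq0.
rewrite -{1}[f]reprK; move: (repr f) d0 => x d0.
rewrite !piE; apply/eqmodP.
by rewrite /= FracField.equivfE /FracField.mulf !numden_Ratio ?mulf_neq0 ?oner_neq0 // !mulr1 mulrC.
Qed.

(** Words stay plain lists so that the combinatorics above applies; the default 0 is read only if
    [l] is shorter than [r]. *)
Definition subst_word l : r.-tuple P := [tuple nth 0 l i | i < r].

Definition var_word : seq P := [seq 'X_i | i <- enum 'I_r].

Definition comp_word l p : P := p \mPo subst_word l.

(** Algebraic independence over the rationals: substitution then keeps denominators nonzero and acts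
    properly on fractions. *)
Definition independent l := size l = r /\ forall p, comp_word l p = 0 -> p = 0.

Lemma comp_mpolyA (t t' : r.-tuple P) p :
  (p \mPo t) \mPo t' = p \mPo [tuple tnth t i \mPo t' | i < r].
Proof.
rewrite [p \mPo t]comp_mpolyE [RHS]comp_mpolyE raddf_sum; apply: eq_bigr => m _.
rewrite /= comp_mpolyZ rmorph_prod; congr (_ *: _); apply: eq_bigr => i _.
by rewrite rmorphXn tnth_mktuple.
Qed.

Lemma size_var_word : size var_word = r.
Proof. by rewrite size_map size_enum_ord. Qed.

Lemma nth_var_word (i : 'I_r) : nth 0 var_word i = 'X_i.
Proof. by rewrite (nth_map i) ?size_enum_ord // nth_ord_enum. Qed.

Lemma subst_var_word : subst_word var_word = [tuple 'X_i | i < r].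
Proof. by apply: eq_from_tnth => i; rewrite !tnth_mktuple nth_var_word. Qed.

Lemma comp_word_word l w p : size w = r ->
  comp_word l (comp_word w p) = comp_word (map (comp_word l) w) p.
Proof.
move=> sw; rewrite /comp_word comp_mpolyA; congr (_ \mPo _).
by apply: eq_from_tnth => i; rewrite !tnth_mktuple (nth_map 0) ?sw.
Qed.

Lemma comp_word_var l : size l = r -> map (comp_word l) var_word = l.
Proof.
move=> sl; apply: (@eq_from_nth _ 0); rewrite size_map size_var_word // => i ir.
rewrite (nth_map 0) ?size_var_word // (nth_var_word (Ordinal ir)).
by rewrite /comp_word comp_mpolyXU -tnth_nth tnth_mktuple.
Qed.

Lemma independent_comp l w :
  independent l -> independent w -> independent (map (comp_word l) w).
Proof.
move=> [sl il] [sw iw]; split=> [|p]; first by rewrite size_map.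
by rewrite -comp_word_word // => /il/iw.
Qed.

(** Operations on words that commute with substitution are determined, on words of length [r], by
    their effect on the word of variables. *)
Definition natural_op (Phi : seq P -> seq P) := forall l w, size w = r ->
  map (comp_word l) (Phi w) = Phi (map (comp_word l) w).

Lemma independent_op Phi Psi l : natural_op Phi ->
    (forall w, size w = r -> size (Phi w) = r) -> size (Psi var_word) = r ->
    Phi (Psi var_word) = var_word ->
  independent l -> independent (Phi l).
Proof.
move=> nat_Phi size_Phi size_Psi PhiK l_ind; have [sl _] := l_ind.
rewrite -{1}(comp_word_var sl) -nat_Phi ?size_var_word //.
apply: independent_comp => //; split=> [|p]; first by rewrite size_Phi ?size_var_word.
move/(congr1 (comp_word (Psi var_word))).
rewrite comp_word_word ?size_Phi ?size_var_word // nat_Phi ?size_var_word //.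
by rewrite comp_word_var // PhiK /comp_word subst_var_word comp_mpoly_id comp_mpoly0.
Qed.

Lemma independent_var : independent var_word.
Proof.
by split=> [|p]; rewrite ?size_var_word // /comp_word subst_var_word comp_mpoly_id.
Qed.

Lemma natural_op_perm (h : 'S_r) : natural_op (fun l => map (nth 0 l) (perm_word h)).
Proof.
move=> l w sw; rewrite -map_comp; apply/eq_in_map => k.
by rewrite (perm_mem (perm_word_iota _)) mem_iota /= => kr; rewrite (nth_map 0) ?sw.
Qed.

Lemma independent_perm s t : perm_eq s t -> independent s -> independent t.
Proof.
move=> st s_ind; have [ss _] := s_ind.
rewrite perm_sym in st; have [I pI ->] := perm_iotaP 0 st.
rewrite ss in pI; have [h <-] := perm_wordP pI.
apply: (@independent_op (fun l => map (nth 0 l) (perm_word h))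
   (fun l => map (nth 0 l) (perm_word h^-1%g))) => //.
- exact: natural_op_perm.
- by move=> w _; rewrite size_map size_perm_word.
- by rewrite size_map size_perm_word.
apply: (@eq_from_nth _ 0); rewrite size_map size_perm_word ?size_var_word // => j jr.
have iE (k : 'S_r) l (i : 'I_r) : nth 0 (map (nth 0 l) (perm_word k)) i = nth 0 l (k i).
  by rewrite (nth_map 0%N) ?size_perm_word // nth_perm_word.
by rewrite (iE h _ (Ordinal jr)) iE permK.
Qed.

(** [subst] uses the representative chosen by [repr]. Equality by cross multiplication survives
    substitution, so any other numerator and denominator give the same value. *)
Lemma subst_frac l p q : independent l -> q != 0 ->
  subst (subst_word l) (tofrac p / tofrac q) =
  tofrac (comp_word l p) / tofrac (comp_word l q).
Proof.
move=> [_ il] q0; set f := tofrac p / tofrac q; rewrite /subst -!/(comp_word l _).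
have comp0 p' : p' != 0 -> tofrac (comp_word l p') != 0.
  by rewrite tofrac_eq0; apply: contraNneq => /il ->.
have d0 := denom_ratioP (repr f).
apply/eqP; rewrite eqr_div ?comp0 // -!tofracM -!rmorphM tofrac_eq; apply/eqP.
congr (_ \mPo _); apply/eqP; rewrite -tofrac_eq !tofracM.
by rewrite -eqr_div ?tofrac_eq0 // -frac_repr.
Qed.

Lemma subst0 (t : r.-tuple P) : subst t 0 = 0.
Proof.
have d0 := denom_ratioP (repr (0 : rfun r)).
have /esym/eqP := frac_repr (0 : rfun r).
rewrite mulf_eq0 invr_eq0 !tofrac_eq0 (negbTE d0) orbF => /eqP n0.
by rewrite /subst n0 comp_mpoly0 tofrac0 mul0r.
Qed.

Lemma substD l : independent l -> {morph subst (subst_word l) : f g / f + g}.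
Proof.
move=> l_ind f g; have [_ il] := l_ind.
have d0 := denom_ratioP (repr f); have d0' := denom_ratioP (repr g).
have c0 p : p != 0 -> tofrac (comp_word l p) != 0.
  by rewrite tofrac_eq0; apply: contraNneq => /il ->.
rewrite [f]frac_repr [g]frac_repr addf_div ?tofrac_eq0 // -!tofracM -tofracD.
rewrite !subst_frac ?mulf_neq0 // addf_div ?c0 //.
by rewrite -!tofracM -tofracD /comp_word !rmorphD !rmorphM.
Qed.

Lemma subst_sum l (I : Type) (e : seq I) (Q : pred I) (G : I -> rfun r) :
  independent l ->
  subst (subst_word l) (\sum_(i <- e | Q i) G i) =
  \sum_(i <- e | Q i) subst (subst_word l) (G i).
Proof. by move=> l_ind; apply: big_morph; [exact: substD | exact: subst0]. Qed.

Lemma subst_var f : subst (subst_word var_word) f = f.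
Proof. by rewrite /subst subst_var_word !comp_mpoly_id -frac_repr. Qed.

Lemma subst_comp l w f : independent l -> independent w ->
  subst (subst_word l) (subst (subst_word w) f) = subst (subst_word (map (comp_word l) w)) f.
Proof.
move=> l_ind w_ind; have [sw iw] := w_ind.
have d0 := denom_ratioP (repr f).
rewrite {1}[f]frac_repr !subst_frac ?comp_word_word //.
by apply/negP => /eqP/iw/eqP; apply/negP.
Qed.

(** This carries an identity stated at the variables over to every independent word. *)
Lemma subst_op Phi l f : natural_op Phi -> independent l -> independent (Phi var_word) ->
  subst (subst_word l) (subst (subst_word (Phi var_word)) f) = subst (subst_word (Phi l)) f.
Proof.
move=> nat_Phi l_ind Phi_ind; have [sl _] := l_ind.
by rewrite subst_comp // nat_Phi ?size_var_word // comp_word_var.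
Qed.

End Substitution.

(** * Operations preserving independence, and the tuples of the definitions as words *)

Section Independence.
Local Open Scope ring_scope.
Variable r : nat.
Local Notation P := {mpoly rat[r]}.
Implicit Types (l w : seq P).

Lemma map_push_word (T T' : zmodType) (g : {additive T -> T'}) (s : seq T) :
  map g (push_word s) = push_word (map g s).
Proof.
rewrite /push_word big_map -raddf_sum -raddfN; move: (- _) => x.
by elim: s x => [|a s IHs] x //=; rewrite IHs.
Qed.

Lemma map_diff_word (T T' : zmodType) (g : {additive T -> T'}) (s : seq T) :
  map g (diff_word s) = diff_word (map g s).
Proof.
rewrite /diff_word -[in RHS](raddf0 g); move: 0 => x.
by elim: s x => [|a s IHs] x //=; rewrite IHs raddfB.
Qed.

Lemma map_sum_word (T T' : zmodType) (g : {additive T -> T'}) (s : seq T) :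
  map g (sum_word s) = sum_word (map g s).
Proof.
rewrite /sum_word -[in RHS](raddf0 g); move: 0 => x.
by elim: s x => [|a s IHs] x //=; rewrite IHs raddfD.
Qed.

Lemma natural_push : natural_op (@push_word P).
Proof. by move=> l w _; exact: (map_push_word (comp_mpoly (subst_word l))). Qed.

Lemma natural_swap : natural_op (fun w : seq P => diff_word (rev w)).
Proof.
move=> l w _; rewrite -map_rev; exact: (map_diff_word (comp_mpoly (subst_word l))).
Qed.

Lemma natural_rot i : natural_op (rot i : seq P -> seq P).
Proof. by move=> l w _; rewrite map_rot. Qed.

Lemma independent_push l : independent l -> independent (push_word l).
Proof.
(* The inverse of push drops the first letter and appends minus the sum of all letters. *)
apply: (@independent_op _ _ (fun w => if w is _ :: s then rcons s (- \sum_(x <- w) x) else [::])).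
- exact: natural_push.
- by move=> w sw; rewrite size_push_word.
- by have := size_var_word r; case: (var_word r) => // x s; rewrite size_rcons.
case: (var_word r) => // x s; rewrite /push_word belast_rcons -cats1 big_cat big_seq1 /=.
by rewrite big_cons opprD opprK addrCA addNr addr0.
Qed.

Lemma independent_opp l : independent l -> independent (map -%R l).
Proof.
apply: (@independent_op _ _ (map -%R)).
- move=> m w _; elim: w => //= x w ->; congr (_ :: _); exact: comp_mpolyN.
- by move=> w; rewrite size_map.
- by rewrite size_map size_var_word.
by rewrite -map_comp map_id_in // => x _ /=; rewrite opprK.
Qed.

Lemma independent_sum l : independent l -> independent (sum_word l).
Proof.
apply: (@independent_op _ _ (@diff_word _)).
- by move=> m w _; exact: (map_sum_word (comp_mpoly (subst_word m))).
- by move=> w; rewrite size_sum_word.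
- by rewrite size_diff_word size_var_word.
exact: diff_wordK.
Qed.

Lemma independent_diff l : independent l -> independent (diff_word l).
Proof.
apply: (@independent_op _ _ (@sum_word _)).
- by move=> m w _; exact: (map_diff_word (comp_mpoly (subst_word m))).
- by move=> w; rewrite size_diff_word.
- by rewrite size_sum_word size_var_word.
exact: sum_wordK.
Qed.

Lemma independent_rev l : independent l -> independent (rev l).
Proof. by apply: independent_perm; rewrite perm_sym perm_rev. Qed.

Lemma independent_rot i l : independent l -> independent (rot i l).
Proof. by apply: independent_perm; rewrite perm_sym perm_rot. Qed.

Lemma XnE k : Xn r k = nth 0 (var_word r) k.
Proof.
rewrite /Xn; case: insubP => [i _ <-|]; first by rewrite nth_var_word.
by rewrite -leqNgt => rk; rewrite nth_default ?size_var_word.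
Qed.

Lemma perm_tupleE (s : 'S_r) :
  perm_tuple s = subst_word (map (nth 0 (var_word r)) (perm_word s)).
Proof.
apply: eq_from_tnth => i; rewrite !tnth_mktuple (nth_map 0%N) ?size_perm_word //.
by rewrite nth_perm_word nth_var_word.
Qed.

Lemma swap_tupleE : swap_tuple r = subst_word (diff_word (rev (var_word r))).
Proof.
apply: eq_from_tnth => i; rewrite !tnth_mktuple !XnE.
rewrite (nth_pairmap 0) ?size_rev ?size_var_word //.
(* Position 0 is the difference with the initial 0, hence the plain variable v_r. *)
case: i => [[|i] ir] /=; first by rewrite subr0 nth_rev ?size_var_word // subn1.
rewrite !nth_rev ?size_var_word ?(ltnW ir) //.
by rewrite -subn1 -subnDA add1n.
Qed.

Lemma push_tupleE : push_tuple r = subst_word (push_word (var_word r)).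
Proof.
apply: eq_from_tnth => i; rewrite !tnth_mktuple !XnE /push_word.
have := lastI (- \sum_(x <- var_word r) x) (var_word r).
move/(congr1 (fun s => nth 0 s i)); rewrite nth_rcons size_belast size_var_word ltn_ord => <-.
case: i => [[|i] ir] //=.
by rewrite big_map big_enum; congr (- _); apply: eq_bigl.
Qed.

Lemma circ_tupleE i : (i < r)%N -> circ_tuple r i = subst_word (rot i (var_word r)).
Proof.
move=> ir; apply: eq_from_tnth => k; rewrite !tnth_mktuple XnE /rot nth_cat size_drop size_var_word.
have kr := ltn_ord k; case: ltnP => kl.
  by rewrite nth_drop addnC modn_small // -ltn_subRL.
have -> : (k + i = k - (r - i) + r)%N by lia.
by rewrite modnDr nth_take ?modn_small //; lia.
Qed.

End Independence.

(** * Moulds *)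

Section Moulds.
Local Open Scope ring_scope.

Lemma alternal_on_eq (T : eqType) (K : nzRingType) (D : seq T -> Prop) (F G : seq T -> K) :
    (forall s t, perm_eq s t -> D s -> D t) -> (forall w, D w -> F w = G w) ->
  alternal_on D F -> alternal_on D G.
Proof.
move=> D_perm FG F_alt u v u0 v0 Duv; rewrite -[RHS](F_alt u v u0 v0 Duv).
apply: eq_big_seq => w /perm_shuffle wuv; apply/esym/FG.
by apply: D_perm Duv; rewrite perm_sym.
Qed.

Section Depth.
Variable r : nat.
Implicit Types (f : rfun r) (l : seq {mpoly rat[r]}).

(** The definition covers only cuts up to r/2 of the word of variables. Commutativity of the shuffle
    gives the other cuts, and substituting [u ++ v] for the variables gives the other words. *)
Lemma alternal_onP f :
  (forall i : nat, (1 <= i <= r./2)%N ->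
     \sum_(s : 'S_r | is_shuffle i s) subst (perm_tuple s) f = 0) <->
  alternal_on (@independent r) (fun l => subst (subst_word l) f).
Proof.
split=> [alt u v|alt i /andP[i0 ir]]; last first.
  have lt_ir : (i < r)%N by lia.
  rewrite (eq_bigr (fun s : 'S_r =>
    subst (subst_word [seq nth 0 (var_word r) k | k <- perm_word s]) f)); last first.
    by move=> s _; rewrite perm_tupleE.
  rewrite (@sum_is_shuffle _ 0 _ (fun l => subst (subst_word l) f) r i) //; first last.
  - exact: ltnW.
  - exact: size_var_word.
  apply: alt; rewrite -?size_eq0 ?size_take ?size_drop ?size_var_word ?lt_ir.
  - by rewrite -lt0n.
  - by rewrite subn_eq0 -ltnNge.
  by rewrite cat_take_drop; apply: independent_var.
wlog uv : u v / (size u <= size v)%N => [IH|] u0 v0 uv_ind.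
  case/orP: (leq_total (size u) (size v)) => uv; first exact: IH.
  rewrite shuffle_sumC; apply: IH => //.
  by apply: independent_perm uv_ind; rewrite perm_catC.
have [suv _] := uv_ind; move: (suv); rewrite size_cat => /eqP suv'.
have /andP[ur ur2] : (size u <= r)%N && ((size u).*2 <= r)%N.
  by move: suv' uv; move: (size u) (size v) => m n /eqP <- mn; rewrite leq_addr -addnn leq_add2l.
have /alt/(congr1 (subst (subst_word (u ++ v)))) : (1 <= size u <= r./2)%N.
  by rewrite lt0n size_eq0 u0 geq_half_double.
rewrite subst0 subst_sum // => sum0; rewrite -[RHS]sum0.
have := @sum_is_shuffle _ 0 _ (fun l => subst (subst_word l) f) _ _ _ suv ur.
rewrite take_size_cat // drop_size_cat // => <-.
apply: eq_bigr => s _; rewrite perm_tupleE (@subst_op _ (fun l => map (nth 0 l) (perm_word s))) //.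
  exact: natural_op_perm.
apply: (@independent_perm _ (var_word r)); last exact: independent_var.
rewrite -[X in perm_eq X](mkseq_nth 0) size_var_word perm_map // perm_sym.
exact: perm_word_iota.
Qed.

Lemma circ_neutralP f :
  \sum_(i < r) subst (circ_tuple r i) f = 0 <->
  forall l, independent l -> \sum_(i < r) subst (subst_word (rot i l)) f = 0.
Proof.
split=> [circ l l_ind|circ].
  have /(congr1 (subst (subst_word l))) := circ.
  rewrite subst0 subst_sum // => sum0; rewrite -[RHS]sum0; apply: eq_bigr => i _.
  rewrite circ_tupleE // (@subst_op _ (rot i)) //; first exact: natural_rot.
  by apply: independent_rot; apply: independent_var.
rewrite -[RHS](circ _ (independent_var r)); apply: eq_bigr => i _.
by rewrite circ_tupleE.
Qed.

Lemma push_invariantP f :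
  subst (push_tuple r) f = f <->
  forall l, independent l -> subst (subst_word (push_word l)) f = subst (subst_word l) f.
Proof.
rewrite push_tupleE; split=> [inv l l_ind|inv]; last first.
  by rewrite inv ?subst_var //; apply: independent_var.
rewrite -[in RHS]inv (subst_op _ (@natural_push r)) //.
by apply: independent_push; apply: independent_var.
Qed.

Lemma subst_swap (A : mould) l : independent l ->
  subst (subst_word l) (swap A r) = subst (subst_word (diff_word (rev l))) (A r).
Proof.
move=> l_ind; rewrite /swap swap_tupleE (subst_op _ (@natural_swap r)) //.
by apply: independent_diff; apply: independent_rev; apply: independent_var.
Qed.

Lemma lreg2 : GRing.lreg (2 : rfun r).
Proof.
apply: mulfI; rewrite -(rmorph_nat (@FracField.tofrac {mpoly rat[r]}) 2) tofrac_eq0.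
by rewrite -mpolyC_nat mpolyC_eq0.
Qed.

End Depth.

Lemma neg_tuple1E : neg_tuple1 = push_tuple 1.
Proof.
apply: eq_from_tnth => i; rewrite !tnth_mktuple; case: i => [[|//] i1] /=.
by rewrite big_ord1; congr (- 'X_ _); apply: val_inj.
Qed.

Lemma al_al_push_circ (A : mould) : ARI_al_al A -> ARI_alpush_circneut A.
Proof.
case=> A0 [A_alt [sA_alt A1]]; split=> //; split=> //.
have F_alt r : (2 <= r)%N -> alternal_on (@independent r) (fun l => subst (subst_word l) (A r)).
  by move=> r2; apply/alternal_onP => i; apply: A_alt.
have sF_alt r : (2 <= r)%N ->
    alternal_on (@independent r) (fun l => subst (subst_word l) (swap A r)).
  by move=> r2; apply/alternal_onP => i; apply: sA_alt.
(* Depth 0 holds since A is zero there; in depth 1 push is negation, so the parity condition is what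
   is asked. *)
split=> [[|[|r]]|r r1].
- by rewrite A0 subst0.
- by rewrite -neg_tuple1E A1.
- apply/push_invariantP => l l_ind; have [sl _] := l_ind.
  apply: (@alternal_swap_push _ _ (@independent r.+2) _ _ _ _
            (fun l => subst (subst_word l) (A r.+2))); rewrite ?sl //.
  + exact: independent_perm.
  + exact: independent_push.
  + exact: independent_opp.
  + exact: independent_sum.
  + exact: lreg2.
  + exact: F_alt.
  apply: alternal_on_eq (sF_alt _ _) => //; first exact: independent_perm.
  by move=> w w_ind; rewrite subst_swap.
apply/circ_neutralP => l l_ind; have [sl _] := l_ind.
have := @alternal_cyclic _ _ (@independent r) (fun l => subst (subst_word l) (swap A r))
  (@independent_perm r) (sF_alt _ r1) l l_ind.
(* With [G] defined on all naturals, the bound [size l] of the sum can be rewritten to [r]. *)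
pose G i := subst (subst_word (rot i l)) (swap A r).
by rewrite -(big_mkord xpredT G) sl big_mkord; apply.
Qed.

(** * The converse inclusion in depths 1, 2 and 3 *)

Lemma circ_push_depth3 (A : mould) (a b c : {mpoly rat[3]}) :
    subst (push_tuple 3) (A 3) = A 3 ->
    \sum_(i < 3) subst (circ_tuple 3 i) (swap A 3) = 0 ->
    independent [:: c; b; a] ->
  subst (subst_word [:: b; a; c]) (swap A 3) = subst (subst_word [:: c; a; b]) (swap A 3).
Proof.
move=> /push_invariantP inv /circ_neutralP circ l_ind.
have push3 (x y z t : {mpoly rat[3]}) : t + x + y + z = 0 ->
    push_word [:: x; y; z] = [:: t; x; y].
  rewrite /push_word !big_cons big_nil addr0 !addrA => txyz; congr [:: _; _; _].
  by apply: addr0_eq; rewrite -[RHS]txyz; ring.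
have word_ind : independent [:: a; b - a; c - b].
  by have := independent_diff (independent_rev l_ind); rewrite /diff_word /rev /= subr0.
have push_ind (x y z t : {mpoly rat[3]}) : t + x + y + z = 0 ->
    independent [:: x; y; z] -> independent [:: t; x; y].
  by move=> txyz /independent_push; rewrite (push3 _ _ _ t).
(* The letters a, b - a, c - b, - c have zero sum, so three pushes lead from the first three to the
   last three. *)
have word'_ind : independent [:: b - a; c - b; - c].
  apply/(push_ind _ _ a); first by ring.
  apply/(push_ind _ _ (b - a)); first by ring.
  by apply/(push_ind _ _ (c - b)); first by ring.
(* The points c, b and 0 as seen from a. *)
have m_ind : independent [:: c - a; b - a; - a].
  apply: (@independent_perm _ [:: b - a; c - a; - a]).
    by rewrite (perm_catCA [:: _] [:: _]).
  have := independent_sum word'_ind; rewrite /sum_word /= add0r.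
  have -> : b - a + (c - b) = c - a by ring.
  by have -> : c - a - c = - a by ring.
pose F l := subst (subst_word l) (A 3).
have swapE (x y z : {mpoly rat[3]}) : independent [:: x; y; z] ->
    subst (subst_word [:: x; y; z]) (swap A 3) = F [:: z; y - z; x - y].
  by move=> ind; rewrite subst_swap // /diff_word /rev /= subr0.
have pushF (x y z t : {mpoly rat[3]}) : t + x + y + z = 0 ->
    independent [:: x; y; z] -> F [:: t; x; y] = F [:: x; y; z].
  by move=> txyz ind; rewrite -(push3 _ _ _ _ txyz) /F inv.
have rot_ind (x y z : {mpoly rat[3]}) : independent [:: x; y; z] -> independent [:: y; z; x].
  exact: (@independent_rot _ 1).
have circF (x y z : {mpoly rat[3]}) : independent [:: x; y; z] ->
    F [:: z; y - z; x - y] + F [:: x; z - x; y - z] + F [:: y; x - y; z - x] = 0.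
  move=> ind; rewrite -(circ _ ind) !big_ord_recl big_ord0 addr0 addrA.
  by rewrite -!swapE //; [apply/rot_ind/rot_ind | apply/rot_ind].
have cab_ind : independent [:: c; a; b].
  by apply: independent_perm l_ind; rewrite perm_cons (perm_catC [:: b] [:: a]).
have bca_ind : independent [:: b; c - b; a - c].
  have := independent_diff (independent_rev (rot_ind _ _ _ (rot_ind _ _ _ l_ind))).
  by rewrite /diff_word /rev /= subr0.
have bac_ind : independent [:: b; a - b; c - a].
  by have := independent_diff (independent_rev cab_ind); rewrite /diff_word /rev /= subr0.
have push2_ind : independent [:: c - a; - c; b].
  apply/(push_ind _ _ (a - b)); first by ring.
  by apply/(push_ind _ _ (c - a)); first by ring.
have push3_ind : independent [:: a - b; c - a; - c].
  by apply/(push_ind _ _ b); first by ring.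
rewrite !swapE //; last first.
  by apply: independent_perm l_ind; rewrite (perm_catC [:: c] [:: b; a]) perm_cons.
(* Relations based at a and at 0 for the points 0, a, b, c. *)
have := circF _ _ _ l_ind; have := circF _ _ _ m_ind.
have -> : b - a - - a = b by ring.
have -> : c - a - (b - a) = c - b by ring.
have -> : - a - (c - a) = - c by ring.
(* Push-invariance moves the terms based at a to (b, c - b, a - c), (a, b - a, c - b) and (b, a - b,
   c - a). The first two also occur in the relation based at 0, so the remaining terms of the two
   relations are equal. *)
rewrite (pushF b (c - b) (a - c)) //; last by ring.
rewrite -(pushF (b - a) (c - b) (- c) a) //; last by ring.
rewrite -(pushF (c - a) (- c) b (a - b)) //; last by ring.
rewrite -(pushF (a - b) (c - a) (- c) b) //; last by ring.
move=> sum1 sum2; apply: (addrI (F [:: a; b - a; c - b] + F [:: b; c - b; a - c])).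
by rewrite addrAC sum2 -addrA addrC sum1.
Qed.

(** In depths 2 and 3 the shorter factor of a shuffle is a single letter, and each such relation can
    be matched with a sum over rotations. Depth 1 carries only the parity condition, which is
    push-invariance there. *)
Lemma push_circ_al_al (r : nat) (A : mould) : r = 1%N \/ r = 2%N \/ r = 3%N ->
  concentrated r A -> ARI_alpush_circneut A -> ARI_al_al A.
Proof.
move=> r123 A_conc [A0 [A_alt [A_push A_circ]]]; split=> //; split=> //; split; last first.
  by rewrite neg_tuple1E A_push.
move=> s s2 i iP; have [sr|/eqP sr] := eqVneq s r; last first.
  by rewrite big1 // => h _; rewrite /swap A_conc // !subst0.
move: i iP; apply/alternal_onP => u v u0 v0 uv_ind; have [suv _] := uv_ind.
rewrite size_cat in suv.
wlog uv : u v u0 v0 uv_ind suv / (size u <= size v)%N => [IH|].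
  case/orP: (leq_total (size u) (size v)) => uv; first exact: IH.
  rewrite shuffle_sumC; apply: IH; rewrite // 1?addnC //.
  by apply: independent_perm uv_ind; rewrite perm_catC.
have /circ_neutralP circ := A_circ _ s2.
have s23 : s = 2%N \/ s = 3 by move: s2; rewrite sr; case: r123 => [->|[]->] // _; [left | right].
have [su sv] : size u = 1%N /\ size v = s.-1.
  move: u0 suv uv s23; rewrite -size_eq0.
  by move: (size u) (size v) => m n m0 mn m_le; case=> s_eq; lia.
case: u su u0 uv suv uv_ind circ => [//|a [|//]] _ _ _ _ uv_ind circ.
clear r123 A_conc; subst r; case: s23 => s_eq; subst s.
  case: v sv v0 uv_ind circ => [//|b [|//]] _ _ uv_ind circ.
  rewrite -[RHS](circ _ uv_ind) !big_ord_recl big_ord0 /= !big_cons big_nil; exact: erefl.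
case: v sv v0 uv_ind circ => [//|b [//|c [|//]]] _ _ uv_ind circ.
rewrite -[RHS](circ _ uv_ind) !big_ord_recl big_ord0 /= !big_cons big_nil.
(* Shuffling a into b c gives abc, bac, bca, while the rotations are abc, bca, cab: it remains to
   exchange bac with cab. *)
rewrite (@circ_push_depth3 A a b c) //; last first.
- by apply: independent_perm uv_ind; rewrite perm_sym; exact: (permEl (perm_rev [:: a; b; c])).
- exact: A_circ.
by congr (_ + _); rewrite addrCA; exact: erefl.
Qed.

End Moulds.

Theorem theorem14 :
  (forall A : mould, ARI_al_al A -> ARI_alpush_circneut A) /\
  (forall r : nat, r = 1 \/ r = 2 \/ r = 3 ->
     forall A : mould, concentrated r A ->
       (ARI_al_al A <-> ARI_alpush_circneut A)).
Proof.
split=> [A|r r123 A A_conc]; first exact: al_al_push_circ.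
by split; [exact: al_al_push_circ | exact: (push_circ_al_al r123 A_conc)].
Qed.
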